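(* Let $V$ be a complex vector space and $\varphi:\mathfrak{gl}_{1,1}\to\mathrm{End}(V)$ a representation, and write $\varepsilon_j=\varphi(\epsilon_j)$ ($j=1,2$), $\mathrm h=\varphi(h)$, $\mathrm e=\varphi(e)$, $\mathrm f=\varphi(f)$. Suppose $u\in V$ satisfies $\varepsilon_ju=\lambda_ju$ ($j=1,2$), $\mathrm hu=\xi u$ and $\mathrm fu=0$ for some $\lambda_1,\lambda_2,\xi\in\mathbb C$. Let $w=\mathrm eu$. Then $$\mathrm ew=0,\quad \mathrm hw=-\xi w,\quad \varepsilon_1w=(\lambda_1-1)w,\quad \varepsilon_2w=-(\lambda_2-\xi)w,\quad \mathrm fw=(\lambda_1\xi-\lambda_2)u.$$
   Context: $\mathfrak{gl}_{1,1}$ is the unital associative $\mathbb C$-algebra generated by $h$ (invertible), $e$, $f$, $\epsilon_1$, $\epsilon_2$ with the relations, where $[a,b]=ab-ba$ and $[[a,b]]=ab+ba$: $[\epsilon_1,\epsilon_2]=[h,\epsilon_1]=[h,\epsilon_2]=0$; $[\epsilon_1,e]=-e$; $[\epsilon_1,f]=f$; $[[\epsilon_2,e]]=eh$; $[[\epsilon_2,f]]=hf$; $[[f,h]]=[[e,h]]=0$; $[f,e]=\epsilon_1h-\epsilon_2$; $e^2=f^2=0$. *)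

(* Defs.v *)
From HB Require Import structures.
From mathcomp Require Import all_boot all_order all_algebra generic_quotient ring_quotient.
From mathcomp Require Import boolp reals.
From mathcomp.real_closed Require Import complex.
From mathcomp.multinomials Require Import monalg.

Set Implicit Arguments.
Unset Strict Implicit.
Unset Printing Implicit Defensive.

Import GRing.Theory.

Local Open Scope ring_scope.
Local Open Scope quotient_scope.

(* [Ghinv] is a generator for the inverse of [Gh]. *)
Inductive gl11_gen := Gh | Ghinv | Ge | Gf | Geps1 | Geps2.

HB.instance Definition _ := gen_eqMixin gl11_gen.
HB.instance Definition _ := gen_choiceMixin gl11_gen.

Definition gl11_word := seq gl11_gen.
HB.instance Definition _ := Choice.on gl11_word.

Fact gl11_word_unitm (x y : gl11_word) : x ++ y = [::] -> x = [::] /\ y = [::].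
Proof. by case: x y => [|? ?] [|? ?]. Qed.

HB.instance Definition _ := Choice_isMonomialDef.Build gl11_word
  (@catA gl11_gen) (@cat0s gl11_gen) (@cats0 gl11_gen) gl11_word_unitm.

Definition two_sided_ideal (A : nzRingType) (I : A -> Prop) : Prop :=
  [/\ I 0, forall x y, I x -> I y -> I (x - y)
    & forall a x b, I x -> I (a * x * b)].

(* gl_{1,1} over a field: the algebra of the free monoid on the generators,
   modulo the two-sided ideal generated by the relations. *)
Section Gl11.
Variable K : fieldType.

Local Notation free := {malg K[gl11_word]}.

Definition gl11_var (g : gl11_gen) : free := << [:: g] : gl11_word >>.

Local Notation comm a b := (a * b - b * a).
Local Notation anticomm a b := (a * b + b * a).

Local Notation h := (gl11_var Gh).
Local Notation hinv := (gl11_var Ghinv).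
Local Notation e := (gl11_var Ge).
Local Notation f := (gl11_var Gf).
Local Notation eps1 := (gl11_var Geps1).
Local Notation eps2 := (gl11_var Geps2).

Inductive gl11_rel : free -> free -> Prop :=
| rel_h_hinv : gl11_rel (h * hinv) 1
| rel_hinv_h : gl11_rel (hinv * h) 1
| rel_eps1_eps2 : gl11_rel (comm eps1 eps2) 0
| rel_h_eps1 : gl11_rel (comm h eps1) 0
| rel_h_eps2 : gl11_rel (comm h eps2) 0
| rel_eps1_e : gl11_rel (comm eps1 e) (- e)
| rel_eps1_f : gl11_rel (comm eps1 f) f
| rel_eps2_e : gl11_rel (anticomm eps2 e) (e * h)
| rel_eps2_f : gl11_rel (anticomm eps2 f) (h * f)
| rel_f_h : gl11_rel (anticomm f h) 0
| rel_e_h : gl11_rel (anticomm e h) 0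
| rel_f_e : gl11_rel (comm f e) (eps1 * h - eps2)
| rel_e_e : gl11_rel (e ^+ 2) 0
| rel_f_f : gl11_rel (f ^+ 2) 0.

Definition gl11_ideal : {pred free} := fun x =>
  `[< forall I : free -> Prop, two_sided_ideal I ->
      (forall y z, gl11_rel y z -> I (y - z)) -> I x >].

Fact gl11_ideal_zmod_closed : zmod_closed gl11_ideal.
Proof.
split=> [|x y /asboolP Ix /asboolP Iy]; apply/asboolP=> I idI Ir.
  by case: idI.
by case: (idI) => _ IB _; apply: IB; [apply: Ix|apply: Iy].
Qed.

HB.instance Definition _ :=
  GRing.isZmodClosed.Build free gl11_ideal gl11_ideal_zmod_closed.

Fact gl11_idealM a x b : x \in gl11_ideal -> a * x * b \in gl11_ideal.
Proof.
move=> /asboolP Ix; apply/asboolP=> I idI Ir.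
by case: (idI) => _ _ IM; apply: IM; apply: Ix.
Qed.

Fact gl11_free_scalerAr (c : K) (x y : free) : c *: (x * y) = x * (c *: y).
Proof.
have Zc (z : free) : z * c%:MP = c *: z.
  rewrite malgM_def fgmulgU malgZ_def /fgscale; apply: eq_bigr => k _.
  by rewrite mulrC mulm1.
by rewrite -Zc mulrA; apply: esym; apply: Zc.
Qed.

(* 1 != 0: the relations hold in K for h = 1, all other generators 0. *)
Definition gl11_word_char (w : gl11_word) : K :=
  \prod_(g <- w) (if g is (Gh | Ghinv) then 1 else 0).

Fact gl11_word_char_morph : mmorphism gl11_word_char.
Proof. by split=> [x y|]; rewrite /gl11_word_char ?big_nil ?big_cat. Qed.

HB.instance Definition _ :=
  isMultiplicative.Build gl11_word K gl11_word_char gl11_word_char_morph.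

Fact gl11_ideal1 : 1 \notin gl11_ideal.
Proof.
apply/negP => /asboolP.
pose chi : {rmorphism free -> K} := mmap idfun gl11_word_char.
move=> /(_ (fun x => chi x = 0)) chi1.
have chiE g : chi (gl11_var g) = if g is (Gh | Ghinv) then 1 else 0.
  by rewrite /chi /= /gl11_var mmapU mul1r /gl11_word_char big_seq1.
have /eqP : chi 1 = 0; last by rewrite rmorph1 oner_eq0.
apply: chi1.
  split=> [|x y x0 y0|a x b x0]; first exact: rmorph0.
    by rewrite rmorphB x0 y0 subrr.
  by rewrite !rmorphM x0 mulr0 mul0r.
move=> y z [];
  rewrite !(rmorphB, rmorphD, rmorphM, rmorphN, rmorph0, rmorph1, rmorphXn) !chiE;
  by rewrite ?(expr0n, mulr1, mul1r, mulr0, mul0r, subrr, addr0, oppr0).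
Qed.

Definition gl11 := {ideal_quot gl11_ideal}.

HB.instance Definition _ := GRing.Zmodule.on gl11.
HB.instance Definition _ := ZmodQuotient.on gl11.

Local Notation pi := (\pi_gl11 : free -> gl11).

Fact gl11_eq (x y : free) : (pi x == pi y) = (x - y \in gl11_ideal).
Proof. by rewrite Quotient.idealrBE. Qed.

Definition gl11_one : gl11 := pi 1.
Definition gl11_mul (x y : gl11) : gl11 := pi (repr x * repr y).
Definition gl11_scale (c : K) (x : gl11) : gl11 := pi (c *: repr x).

Fact gl11_repr_pi (x : free) : repr (pi x) - x \in gl11_ideal.
Proof. by rewrite -gl11_eq reprK. Qed.

Fact gl11_piM (x y : free) : pi (x * y) = gl11_mul (pi x) (pi y).
Proof.
apply/eqP; rewrite eq_sym gl11_eq.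
set x' := repr _; set y' := repr _.
have -> : x' * y' - x * y = 1 * (x' - x) * y' + x * (y' - y) * 1.
  by rewrite mul1r mulr1 mulrBl mulrBr addrA subrK.
by rewrite rpredD ?gl11_idealM ?gl11_repr_pi.
Qed.

Fact gl11_piZ c (x : free) : pi (c *: x) = gl11_scale c (pi x).
Proof.
apply/eqP; rewrite eq_sym gl11_eq -scalerBr.
rewrite -[_ *: _]mulr1 -[_ - x]mul1r scalerAl.
exact/gl11_idealM/gl11_repr_pi.
Qed.

Fact gl11_piD (x y : free) : pi (x + y) = pi x + pi y.
Proof. exact: raddfD. Qed.

Fact gl11_mulA : associative gl11_mul.
Proof.
elim/quotW=> x; elim/quotW=> y; elim/quotW=> z.
by rewrite -(gl11_piM y z) -(gl11_piM x y) -!gl11_piM mulrA.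
Qed.

Fact gl11_mul1 : left_id gl11_one gl11_mul.
Proof. by elim/quotW=> x; rewrite -gl11_piM mul1r. Qed.

Fact gl11_mulr1 : right_id gl11_one gl11_mul.
Proof. by elim/quotW=> x; rewrite -gl11_piM mulr1. Qed.

Fact gl11_mulDl : left_distributive gl11_mul +%R.
Proof.
elim/quotW=> x; elim/quotW=> y; elim/quotW=> z.
by rewrite -gl11_piD -(gl11_piM x z) -(gl11_piM y z) -gl11_piM -gl11_piD mulrDl.
Qed.

Fact gl11_mulDr : right_distributive gl11_mul +%R.
Proof.
elim/quotW=> x; elim/quotW=> y; elim/quotW=> z.
by rewrite -gl11_piD -(gl11_piM x y) -(gl11_piM x z) -gl11_piM -gl11_piD mulrDr.
Qed.

Fact gl11_one_neq0 : gl11_one != 0.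
Proof.
rewrite -[0](raddf0 pi) gl11_eq subr0; exact: gl11_ideal1.
Qed.

HB.instance Definition _ := GRing.Zmodule_isNzRing.Build gl11
  gl11_mulA gl11_mul1 gl11_mulr1 gl11_mulDl gl11_mulDr gl11_one_neq0.

Fact gl11_scaleA a b x : gl11_scale a (gl11_scale b x) = gl11_scale (a * b) x.
Proof. by elim/quotW: x => x; rewrite -(gl11_piZ b) -!gl11_piZ scalerA. Qed.

Fact gl11_scale1 : left_id 1 gl11_scale.
Proof. by elim/quotW=> x; rewrite -gl11_piZ scale1r. Qed.

Fact gl11_scaleDr : right_distributive gl11_scale +%R.
Proof.
move=> a; elim/quotW=> x; elim/quotW=> y.
by rewrite -gl11_piD -(gl11_piZ a x) -(gl11_piZ a y) -gl11_piZ -gl11_piD scalerDr.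
Qed.

Fact gl11_scaleDl x : {morph gl11_scale^~ x : a b / a + b}.
Proof.
elim/quotW: x => x a b; rewrite -(gl11_piZ a) -(gl11_piZ b).
by rewrite -gl11_piZ -gl11_piD scalerDl.
Qed.

HB.instance Definition _ := GRing.Zmodule_isLmodule.Build K gl11
  gl11_scaleA gl11_scale1 gl11_scaleDr gl11_scaleDl.

Fact gl11_scalerAl (c : K) (x y : gl11) : c *: (x * y) = c *: x * y.
Proof.
elim/quotW: x => x; elim/quotW: y => y.
rewrite -[LHS]/(gl11_scale c (gl11_mul _ _)).
rewrite -[RHS]/(gl11_mul (gl11_scale c _) _).
by rewrite -(gl11_piM x y) -(gl11_piZ c x) -gl11_piZ -gl11_piM scalerAl.
Qed.

HB.instance Definition _ := GRing.Lmodule_isLalgebra.Build K gl11 gl11_scalerAl.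

Fact gl11_scalerAr (c : K) (x y : gl11) : c *: (x * y) = x * (c *: y).
Proof.
elim/quotW: x => x; elim/quotW: y => y.
rewrite -[LHS]/(gl11_scale c (gl11_mul _ _)).
rewrite -[RHS]/(gl11_mul _ (gl11_scale c _)).
by rewrite -(gl11_piM x y) -(gl11_piZ c y) -gl11_piZ -gl11_piM gl11_free_scalerAr.
Qed.

HB.instance Definition _ := GRing.Lalgebra_isAlgebra.Build K gl11 gl11_scalerAr.

Definition gl11_h : gl11 := pi h.
Definition gl11_e : gl11 := pi e.
Definition gl11_f : gl11 := pi f.
Definition gl11_eps1 : gl11 := pi eps1.
Definition gl11_eps2 : gl11 := pi eps2.

End Gl11.

(* End(V), the product being composition; it is not given a nonzero ring
   structure because V may be 0. *)
Section Endo.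
Variables (K : fieldType) (V : lmodType K).

Definition endo := {linear V -> V}.

HB.instance Definition _ := gen_eqMixin endo.
HB.instance Definition _ := gen_choiceMixin endo.

Fact endo_ext (f g : endo) : f =1 g -> f = g.
Proof.
case: f g => [f [[f1] [f2]]] [g [[g1] [g2]]] /= /funext fg.
subst g; congr GRing.Linear.Pack.
by rewrite (Prop_irrelevance f1 g1) (Prop_irrelevance f2 g2).
Qed.

Definition endo_zero : endo := \0.
Definition endo_add (f g : endo) : endo := f \+ g.
Definition endo_opp (f : endo) : endo := \- f.
Definition endo_scale (c : K) (f : endo) : endo := c \*: f.
Definition endo_one : endo := idfun.
Definition endo_mul (f g : endo) : endo := f \o g.

Fact endo_addA : associative endo_add.
Proof. by move=> f g k; apply: endo_ext => v /=; rewrite addrA. Qed.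

Fact endo_addC : commutative endo_add.
Proof. by move=> f g; apply: endo_ext => v /=; rewrite addrC. Qed.

Fact endo_add0 : left_id endo_zero endo_add.
Proof. by move=> f; apply: endo_ext => v /=; rewrite add0r. Qed.

Fact endo_addN : left_inverse endo_zero endo_opp endo_add.
Proof. by move=> f; apply: endo_ext => v /=; rewrite addNr. Qed.

HB.instance Definition _ :=
  GRing.isZmodule.Build endo endo_addA endo_addC endo_add0 endo_addN.

Fact endo_mulA : associative endo_mul.
Proof. by move=> f g k; apply: endo_ext. Qed.

Fact endo_mul1 : left_id endo_one endo_mul.
Proof. by move=> f; apply: endo_ext. Qed.

Fact endo_mulr1 : right_id endo_one endo_mul.
Proof. by move=> f; apply: endo_ext. Qed.

Fact endo_mulDl : left_distributive endo_mul +%R.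
Proof. by move=> f g k; apply: endo_ext. Qed.

Fact endo_mulDr : right_distributive endo_mul +%R.
Proof. by move=> f g k; apply: endo_ext => v /=; rewrite raddfD. Qed.

HB.instance Definition _ := GRing.Zmodule_isPzRing.Build endo
  endo_mulA endo_mul1 endo_mulr1 endo_mulDl endo_mulDr.

Fact endo_scaleA a b f : endo_scale a (endo_scale b f) = endo_scale (a * b) f.
Proof. by apply: endo_ext => v /=; rewrite scalerA. Qed.

Fact endo_scale1 : left_id 1 endo_scale.
Proof. by move=> f; apply: endo_ext => v /=; rewrite scale1r. Qed.

Fact endo_scaleDr : right_distributive endo_scale +%R.
Proof. by move=> a f g; apply: endo_ext => v /=; rewrite scalerDr. Qed.

Fact endo_scaleDl f : {morph endo_scale^~ f : a b / a + b}.
Proof. by move=> a b; apply: endo_ext => v /=; rewrite scalerDl. Qed.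

HB.instance Definition _ := GRing.Zmodule_isLmodule.Build K endo
  endo_scaleA endo_scale1 endo_scaleDr endo_scaleDl.

End Endo.

(* Main.v *)
Require Import Defs.
From mathcomp Require Import all_boot all_order all_algebra generic_quotient reals.
From mathcomp Require Import boolp.
From mathcomp.real_closed Require Import complex.
From mathcomp.multinomials Require Import monalg.

Set Implicit Arguments.
Unset Strict Implicit.
Unset Printing Implicit Defensive.

Import GRing.Theory.

Local Open Scope ring_scope.
Local Open Scope quotient_scope.

(** Each formula comes from one defining relation: it moves [e] to the left past [h], [eps1], [eps2]
    or [f], after which the other generator acts directly on [u], as an eigenvalue or, for [f], as
    zero. Applying [e] itself to [w] gives zero because [e] squares to zero. The reordering rules
    [gl11_eps1_e] to [gl11_e_e] hold in the quotient algebra, and [gl11_highest_weight] transports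
    them along [phi] over any field. *)

Section Relations.
Variable K : fieldType.

Local Notation free := {malg K[gl11_word]}.
Local Notation pi := (\pi_(gl11 K) : free -> gl11 K).
Local Notation h := (gl11_h K).
Local Notation e := (gl11_e K).
Local Notation f := (gl11_f K).
Local Notation eps1 := (gl11_eps1 K).
Local Notation eps2 := (gl11_eps2 K).

(** The ideal is the intersection of all two-sided ideals containing the differences [y - z] of
    related pairs, so [x - y] lies in it. *)
Lemma gl11_pi_rel (x y : free) : gl11_rel x y -> pi x = pi y.
Proof.
by move=> xy; apply/eqP; rewrite gl11_eq; apply/asboolP=> I _; apply.
Qed.

(** [gl11_piM] with the ring product in place of [gl11_mul], so that generic ring rewriting
    applies. *)
Lemma gl11_piMr (x y : free) : pi (x * y) = pi x * pi y.
Proof. exact: gl11_piM. Qed.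

Lemma gl11_piN (x : free) : pi (- x) = - pi x.
Proof. exact: raddfN. Qed.

Lemma gl11_pi0 : pi 0 = 0.
Proof. exact: raddf0. Qed.

Let piE := (gl11_piD, gl11_piN, gl11_pi0, gl11_piMr).

(** This rule and the next three are relations solved for the product with [e] on the right, ready
    for rewriting. *)
Lemma gl11_eps1_e : eps1 * e = e * eps1 - e.
Proof.
have := gl11_pi_rel (rel_eps1_e K); rewrite !piE => <-.
by rewrite addrC subrK.
Qed.

Lemma gl11_eps2_e : eps2 * e = e * h - e * eps2.
Proof.
have := gl11_pi_rel (rel_eps2_e K); rewrite !piE => <-.
by rewrite addrK.
Qed.

Lemma gl11_h_e : h * e = - (e * h).
Proof.
have := gl11_pi_rel (rel_e_h K); rewrite !piE addrC => /eqP.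
by rewrite addr_eq0 => /eqP.
Qed.

Lemma gl11_f_e : f * e = e * f + (eps1 * h - eps2).
Proof.
have := gl11_pi_rel (rel_f_e K); rewrite !piE => <-.
by rewrite addrC subrK.
Qed.

Lemma gl11_e_e : e * e = 0.
Proof. by have := gl11_pi_rel (rel_e_e K); rewrite expr2 !piE. Qed.

End Relations.

(** This and the next three equations hold by conversion; they turn identities in the endomorphism
    ring into identities of vectors. *)
Lemma endo0 (K : fieldType) (V : lmodType K) v : (0 : endo V) v = 0.
Proof. by []. Qed.

Lemma endoM (K : fieldType) (V : lmodType K) (a b : endo V) v :
  (a * b) v = a (b v).
Proof. by []. Qed.

Lemma endoD (K : fieldType) (V : lmodType K) (a b : endo V) v :
  (a + b) v = a v + b v.
Proof. by []. Qed.

Lemma endoN (K : fieldType) (V : lmodType K) (a : endo V) v : (- a) v = - a v.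
Proof. by []. Qed.

Section HighestWeight.
Variables (K : fieldType) (V : lmodType K).
Variable phi : {lrmorphism gl11 K -> endo V}.

Local Notation h := (phi (gl11_h K) : endo V).
Local Notation e := (phi (gl11_e K) : endo V).
Local Notation f := (phi (gl11_f K) : endo V).
Local Notation eps1 := (phi (gl11_eps1 K) : endo V).
Local Notation eps2 := (phi (gl11_eps2 K) : endo V).

Lemma gl11_highest_weight (u : V) (lambda1 lambda2 xi : K) :
  eps1 u = lambda1 *: u -> eps2 u = lambda2 *: u ->
  h u = xi *: u -> f u = 0 ->
  [/\ e (e u) = 0, h (e u) = - xi *: e u, eps1 (e u) = (lambda1 - 1) *: e u,
      eps2 (e u) = - (lambda2 - xi) *: e u
    & f (e u) = (lambda1 * xi - lambda2) *: u].
Proof.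
(* Each left side becomes the image under [phi] of a product in the algebra, applied to [u], so that
   the rules above apply. *)
move=> eps1u eps2u hu fu; split; rewrite -endoM -rmorphM.
- by rewrite gl11_e_e rmorph0 endo0.
- by rewrite gl11_h_e rmorphN rmorphM endoN endoM hu linearZ scaleNr.
- rewrite gl11_eps1_e rmorphB rmorphM endoD endoN endoM eps1u linearZ.
  by rewrite scalerBl scale1r.
- rewrite gl11_eps2_e rmorphB !rmorphM endoD endoN !endoM hu eps2u !linearZ.
  by rewrite /= scalerN opprB scalerBl.
(* Since [f] kills [u], only the commutator [eps1 * h - eps2] contributes. *)
- rewrite gl11_f_e rmorphD rmorphB !rmorphM !endoD endoN !endoM fu hu eps2u.
  by rewrite linear0 add0r linearZ /= eps1u scalerA scalerBl mulrC.
Qed.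

End HighestWeight.

Theorem lemma4p1 (R : realType) (V : lmodType R[i])
    (phi : {lrmorphism gl11 R[i] -> endo V})
    (u : V) (lambda1 lambda2 xi : R[i]) :
  let eps1 : endo V := phi (gl11_eps1 R[i]) in
  let eps2 : endo V := phi (gl11_eps2 R[i]) in
  let h : endo V := phi (gl11_h R[i]) in
  let e : endo V := phi (gl11_e R[i]) in
  let f : endo V := phi (gl11_f R[i]) in
  eps1 u = lambda1 *: u -> eps2 u = lambda2 *: u ->
  h u = xi *: u -> f u = 0 ->
  let w := e u in
  [/\ e w = 0, h w = - xi *: w, eps1 w = (lambda1 - 1) *: w,
      eps2 w = - (lambda2 - xi) *: w
    & f w = (lambda1 * xi - lambda2) *: u].
Proof. exact: gl11_highest_weight. Qed.
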